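(* Let $n\ge 1$ and let $\Omega=\mathbb{C}[x_1,\dots,x_n]\otimes\wedge\mathbb{C}^n$ be the algebra of polynomial differential forms on $\mathbb{C}^n$. Let $\mathcal{I}$ be the ideal of $\Omega$ generated by $p_1,\dots,p_n,dp_1,\dots,dp_n$, where $p_j=\sum_{i=1}^n x_i^j$ and $d$ is the exterior derivative. For $l,k\ge 0$ let $\Omega^{l,k}$ be the space of forms $\sum_{1\le i_1<\dots<i_k\le n}f_{i_1\dots i_k}\,dx_{i_1}\wedge\cdots\wedge dx_{i_k}$ with each $f_{i_1\dots i_k}$ homogeneous of degree $l$. Then for $0\le k\le n$: if $\omega\in\Omega^{l,k}$ and $l>\binom{n}{2}-\binom{k+1}{2}$, then $\omega\in\mathcal{I}$. Furthermore, for $0\le k\le n-1$, the image of $\Omega^{\binom n2-\binom{k+1}2,k}$ in $\Omega/\mathcal{I}$ is non-zero. *)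

(* Defs.v *)
From mathcomp Require Import all_boot all_order all_algebra.
From mathcomp Require Import mpoly.
Set Implicit Arguments. Unset Strict Implicit. Unset Printing Implicit Defensive.
Import GRing.Theory.
Local Open Scope ring_scope.

(* Polynomial differential forms on C^n: Omega = C[x_1..x_n] (x) /\ C^n.
   A form is represented by its coefficient function S |-> f_S, where S is the
   (increasing) index set {i_1 < ... < i_k} of dx_{i_1} /\ ... /\ dx_{i_k}. *)
Definition pform (C : nzRingType) (n : nat) := {ffun {set 'I_n} -> {mpoly C[n]}}.

(* sign of dx_A /\ dx_B = sgn(A,B) dx_{A u B} for disjoint A, B:
   (-1)^(number of inversions (a, b) with a in A, b in B, b < a). *)
Definition wsign (C : nzRingType) (n : nat) (A B : {set 'I_n}) : {mpoly C[n]} :=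
  (-1) ^+ #|[set ij : 'I_n * 'I_n | (ij.1 \in A) && (ij.2 \in B) && (ij.2 < ij.1)%N]|.

Definition wedge (C : nzRingType) (n : nat) (a b : pform C n) : pform C n :=
  [ffun S : {set 'I_n} => \sum_(A : {set 'I_n}) \sum_(B : {set 'I_n} |
      (A :&: B == set0) && (A :|: B == S)) wsign C A B * a A * b B].

(* exterior derivative: d(f dx_T) = sum_i (d f / d x_i) dx_i /\ dx_T *)
Definition dform (C : nzRingType) (n : nat) (w : pform C n) : pform C n :=
  [ffun S : {set 'I_n} => \sum_(i : 'I_n | i \in S)
      (-1) ^+ #|[set s in S | (s < i)%N]| * (w (S :\ i))^`M(i)].

Definition form0 (C : nzRingType) (n : nat) (p : {mpoly C[n]}) : pform C n :=
  [ffun S : {set 'I_n} => if S == set0 then p else 0].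

Definition psum (C : nzRingType) (n : nat) (j : nat) : pform C n :=
  form0 (\sum_(i < n) 'X_i ^+ j).

(* The ideal I generated by p_1..p_n, dp_1..dp_n. Since each generator is
   homogeneous in form degree (0 or 1), the left ideal they generate in the
   graded-commutative algebra Omega is the two-sided ideal. *)
Definition in_I (C : nzRingType) (n : nat) (w : pform C n) : Prop :=
  exists a b : nat -> pform C n,
    w = \sum_(1 <= j < n.+1)
          (wedge (a j) (psum C n j) + wedge (b j) (dform (psum C n j))).

(* Omega^{l,k}: forms sum_{|S| = k} f_S dx_S with every f_S homogeneous of
   total degree l (the zero polynomial counts as homogeneous of any degree). *)
Definition in_Omega (C : nzRingType) (n : nat) (l k : nat) (w : pform C n) : Prop :=
  forall S : {set 'I_n}, (w S \is l.-homog) /\ (#|S| != k -> w S = 0).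

(* Main.v *)
Require Import Defs.
From mathcomp Require Import all_boot all_order all_fingroup all_algebra.
From mathcomp Require Import mpoly.
From mathcomp Require Import zify ring.
Set Implicit Arguments. Unset Strict Implicit. Unset Printing Implicit Defensive.
Import Order.TTheory GRing.Theory Num.Theory.
Local Open Scope ring_scope.

(* Write [h_m(s)] for the complete homogeneous polynomial in the variables [s],
   [k] for the size of [S] and [N = n - k].

   Upper bound.  Modulo the power sums, [h_m] in [r] of the variables vanishes
   for [m > n - r].  Wedging the [dp_j] with [dx_(S - i)] then gives
   [h_N(x_i, x_S) dx_S = 0] for every [i] in [S]: the annihilator of [dx_S]
   contains the Jacobian ideal of [h_(N+1)(x_S)].  That ideal contains all forms
   in [x_S] of degree [> k(N-1)]; this follows by induction on [N] and on the
   number of variables, comparing the colon ideal by a variable with the sum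
   with that variable.  The variables outside [S] contribute at most
   [(N-1) + .. + 0] to the degree by the monic relations
   [h_(n-r)(x_t, r variables) = 0], and [k(N-1) + C(N,2) = C(n,2) - C(k+1,2)].

   Non-vanishing.  Let [theta_m = \sum_t x_t^m dx_t].  Pair [\sum_S f_S dx_S]
   with [theta_1 /\ .. /\ theta_k] coefficientwise and take the coefficient of
   [\prod_i x_i^i] in the antisymmetrization.  This functional kills multiples
   of power sums; as [dp_j] is adjoint to a contraction which maps [theta_m] to
   the power sum [p_(m+j-1)], it kills the ideal.  It does not kill
   [\prod_(i > k) x_i^i dx_1 .. dx_k], for variables numbered from [0]. *)

(** * Complete homogeneous polynomials *)

Fixpoint hsym (R : comNzRingType) (s : seq R) (m : nat) : R :=
  if s is x :: s' then \sum_(a < m.+1) x ^+ a * hsym s' (m - a) else (m == 0%N)%:R.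

Lemma hsym_cons (R : comNzRingType) (x : R) s m :
  hsym (x :: s) m = \sum_(a < m.+1) x ^+ a * hsym s (m - a).
Proof. by []. Qed.

Lemma hsym0 (R : comNzRingType) (s : seq R) : hsym s 0 = 1.
Proof. by elim: s => [|x s IHs] //=; rewrite big_ord1 expr0 mul1r subn0. Qed.

Lemma hsym_consS (R : comNzRingType) (x : R) s m :
  hsym (x :: s) m.+1 = hsym s m.+1 + x * hsym (x :: s) m.
Proof.
rewrite /= big_ord_recl expr0 mul1r subn0; congr (_ + _).
by rewrite mulr_sumr; apply: eq_bigr => i _; rewrite exprS mulrA subSS.
Qed.

Lemma sum_expr0 (R : comNzRingType) (s : seq R) :
  \sum_(x <- s) x ^+ 0 = (size s)%:R.
Proof. by rewrite -sum1_size natr_sum. Qed.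

Arguments hsym : simpl never.

(* Euler-type form of Newton's identity: the [a = 0] term contributes [size s]. *)
Lemma newton_hsym (R : comNzRingType) (s : seq R) m :
  \sum_(a < m.+1) (\sum_(x <- s) x ^+ a) * hsym s (m - a)
  = (size s + m)%:R * hsym s m.
Proof.
elim: s m => [|t s IHs] m.
  rewrite big1 => [|a _]; last by rewrite big_nil mul0r.
  by case: m => [|m]; rewrite /= ?mul0r ?mulr0.
elim: m => [|m IHm].
  by rewrite big_ord1 subn0 !hsym0 addn0 !mulr1 sum_expr0.
pose p a := \sum_(x <- s) x ^+ a.
have pE k : \sum_(a < k.+1) (\sum_(x <- t :: s) x ^+ a) * hsym (t :: s) (k - a)
   = \sum_(a < k.+1) (t ^+ a + p a) * hsym (t :: s) (k - a).
  by apply: eq_bigr => a _; rewrite big_cons.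
have h'E : \sum_(a < m.+2) t ^+ a * hsym s (m.+1 - a) = hsym (t :: s) m.+1 by [].
move: (IHs m.+1) IHm h'E (hsym_consS t s) (hsym0 s) (hsym0 (t :: s)); rewrite !pE.
move: (hsym s) (hsym (t :: s)) => h h' IHh IHh' h'E h'S h0 h'0.
have E : \sum_(a < m.+2) (t ^+ a + p a) * h' (m.+1 - a)%N
   = \sum_(a < m.+2) p a * h (m.+1 - a)%N + h' m.+1
     + t * \sum_(a < m.+1) (t ^+ a + p a) * h' (m - a)%N.
  rewrite -h'E -big_split mulr_sumr big_ord_recr [X in _ = X + _]big_ord_recr /=.
  rewrite subnn h0 h'0 addrAC.
  congr (_ + _); last by ring.
  rewrite -big_split /=; apply: eq_bigr => a _.
  have /subSn -> : (a <= m)%N by rewrite -ltnS.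
  by rewrite h'S; move: (h _) (h' _) (p _) => *; ring.
rewrite E IHh IHh' h'S /=.
have -> : (size s + m.+1)%:R = (size s + m)%:R + 1 :> R by rewrite addnS natr1.
have -> : ((size s).+1 + m)%:R = (size s + m)%:R + 1 :> R by rewrite addSn natr1.
have -> : ((size s).+1 + m.+1)%:R = (size s + m)%:R + 1 + 1 :> R.
  by rewrite addSn addnS !natr1.
by move: (_%:R) => c; ring.
Qed.

(** Expanding in powers of [x] gives Newton's sum. For distinct variables, the summands are the
    partial derivatives of [h_(m+1)(s)]. *)
Lemma sum_hsym_cons (R : comNzRingType) (s : seq R) m :
  \sum_(x <- s) hsym (x :: s) m = (size s + m)%:R * hsym s m.
Proof.
rewrite -newton_hsym exchange_big /=.
by apply: eq_bigr => a _; rewrite mulr_suml.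
Qed.

(** * Ideals containing the power sums *)

Definition ideal_pred (R : comNzRingType) (G : R -> Prop) :=
  [/\ G 0, forall f g, G f -> G g -> G (f + g) & forall q f, G f -> G (q * f)].

Section IdealPred.
Variables (R : comNzRingType) (G : R -> Prop).
Hypothesis idG : ideal_pred G.

Lemma ideal_pred_sum (I : Type) (r : seq I) (P : pred I) (F : I -> R) :
  (forall i, P i -> G (F i)) -> G (\sum_(i <- r | P i) F i).
Proof. by case: idG => G0 GD _ GF; apply: big_ind. Qed.

Lemma ideal_predB f g : G f -> G g -> G (f - g).
Proof. by case: idG => _ GD GM Gf Gg; rewrite -mulN1r; apply: GD (GM _ _ _). Qed.

Lemma ideal_predMl q f : G f -> G (q * f).
Proof. by case: idG => _ _; apply. Qed.

Lemma ideal_predMr q f : G f -> G (f * q).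
Proof. by rewrite mulrC; apply: ideal_predMl. Qed.
End IdealPred.

Section PowerSumIdeal.
Variables (C : numFieldType) (n : nat) (G : {mpoly C[n]} -> Prop).
Hypothesis idG : ideal_pred G.
Hypothesis Gp : forall j, (0 < j <= n)%N -> G (\sum_(i < n) 'X_i ^+ j).

Lemma natr_mpoly_invK (m : nat) (f : {mpoly C[n]}) :
  (m.+1%:R^-1)%:MP * (m.+1%:R * f) = f.
Proof.
by rewrite mulr_natl mul_mpolyC -scaler_nat scalerA mulVf ?pnatr_eq0 ?scale1r.
Qed.

(** Downward induction on the number of variables. For all of them, Newton's identity leaves
    [m * h_m] in [G], and [m] is invertible; [m <= n] keeps to the available power sums. A variable
    [t] is dropped by [h_(m+1)(s) = h_(m+1)(t, s) - x_t h_m(t, s)]. *)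
Lemma hsym_in_power_sum_ideal (s : seq 'I_n) m :
    uniq s -> (n - size s < m)%N -> (m <= n)%N ->
  G (hsym [seq 'X_i | i <- s] m).
Proof.
move: {2}(n - size s)%N (erefl (n - size s)%N) => c.
elim: c s m => [|c IHc] s m Dc us lt_cm le_mn.
  have sub_s : {subset s <= enum 'I_n} by move=> i _; rewrite mem_enum.
  have le_ns : (size (enum 'I_n) <= size s)%N by rewrite size_enum_ord -subn_eq0 Dc.
  have perm_s : perm_eq s (index_enum 'I_n).
    apply: (uniq_perm us (index_enum_uniq _)) => i.
    by have [_ ->] := uniq_min_size us sub_s le_ns; rewrite mem_index_enum mem_enum.
  case: m lt_cm le_mn => // m _ le_mn.
  rewrite -(natr_mpoly_invK m (hsym _ _)); apply: ideal_predMl => //.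
  have := newton_hsym [seq ('X_i : {mpoly C[n]}) | i <- s] m.+1.
  rewrite big_ord_recl /= subn0 natrD mulrDl.
  rewrite sum_expr0 => /addrI <-; apply: ideal_pred_sum => // a _.
  apply: ideal_predMr => //.
  rewrite big_map (perm_big _ perm_s) /=; apply: Gp.
  by rewrite /bump /= add1n; have := ltn_ord a; lia.
have [t nst] : exists t, t \notin s.
  case: (boolP [exists t, t \notin s]) => [/existsP //|/existsPn hs]; exfalso.
  have := uniq_leq_size (enum_uniq 'I_n) (fun i _ => negPn (hs i)).
  by rewrite size_enum_ord -subn_eq0 Dc.
case: m lt_cm le_mn => // m lt_cm le_mn.
have -> : hsym [seq ('X_i : {mpoly C[n]}) | i <- s] m.+1
    = hsym [seq 'X_i | i <- t :: s] m.+1 - 'X_t * hsym [seq 'X_i | i <- t :: s] m.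
  by rewrite [map _ (_ :: _)]/= hsym_consS addrK.
apply: ideal_predB => //; last apply: ideal_predMl => //.
all: apply: IHc => /=; rewrite ?nst //; lia.
Qed.

End PowerSumIdeal.

(** * Forms of large degree in a Jacobian ideal *)

Section HomogeneousIn.
Variables (C : numFieldType) (n : nat).
Implicit Types (s : seq 'I_n) (f g q : {mpoly C[n]}) (m : 'X_{1..n}).

Definition hom_in s d f :=
  forall m, m \in msupp f -> mdeg m = d /\ forall i, i \notin s -> m i = 0%N.

Lemma hom_in0 s d : hom_in s d 0.
Proof. by move=> m; rewrite msupp0. Qed.

Lemma hom_inX s d m :
  mdeg m = d -> (forall i, i \notin s -> m i = 0%N) -> hom_in s d 'X_[m].
Proof. by move=> dm sm m' /mem_msuppXP <-. Qed.

Lemma hom_inC s c : hom_in s 0 (c%:MP : {mpoly C[n]}).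
Proof.
move=> m; rewrite msuppC; case: ifP => // _; rewrite inE => /eqP ->.
by rewrite mdeg0; split=> // i _; rewrite mnm0E.
Qed.

Lemma hom_inD s d f g : hom_in s d f -> hom_in s d g -> hom_in s d (f + g).
Proof.
by move=> hf hg m /msuppD_le; rewrite mem_cat => /orP[/hf|/hg].
Qed.

Lemma hom_inM s d e f g : hom_in s d f -> hom_in s e g -> hom_in s (d + e) (f * g).
Proof.
move=> hf hg m /msuppM_le /allpairsP[[m1 m2] /= [/hf[<- s1] /hg[<- s2] ->]].
by rewrite mdegD; split=> // i si; rewrite mnmDE s1 ?s2.
Qed.

Lemma hom_in_sum s d (I : Type) (r : seq I) (P : pred I) (F : I -> {mpoly C[n]}) :
  (forall i, P i -> hom_in s d (F i)) -> hom_in s d (\sum_(i <- r | P i) F i).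
Proof. by move=> hF; apply: big_ind => //; [apply: hom_in0 | apply: hom_inD]. Qed.

Lemma hom_in_var s i : i \in s -> hom_in s 1 'X_i.
Proof.
move=> si; apply: hom_inX => [|j sj]; first exact: mdeg1.
by rewrite mnm1E; case: eqP sj => // <-; rewrite si.
Qed.

Lemma hom_in_varX s i a : i \in s -> hom_in s a ('X_i ^+ a).
Proof.
move=> si; elim: a => [|a IHa]; first exact: hom_inC.
by rewrite exprS -add1n; apply: hom_inM => //; apply: hom_in_var.
Qed.

Lemma hom_in_hsym s s' d :
  {subset s' <= s} -> hom_in s d (hsym [seq 'X_i | i <- s'] d).
Proof.
elim: s' d => [|i s' IHs] d sub_s /=.
  by case: d => [|d]; [apply: hom_inC | apply: hom_in0].
apply: hom_in_sum => a _; rewrite -{1}(subnKC (ltnSE (ltn_ord a))).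
apply: hom_inM; first by apply: hom_in_varX; rewrite sub_s ?mem_head.
by apply: IHs => j js; apply: sub_s; rewrite mem_behead.
Qed.

(** The degree is an index because the induction below passes to colon ideals and sums with a
    variable and has to track the degree of each cofactor. *)
Definition graded_ideal s (G : nat -> {mpoly C[n]} -> Prop) :=
  [/\ forall d, G d 0,
      forall d f g, G d f -> G d g -> G d (f + g) &
      forall d e q f, hom_in s e q -> G d f -> G (e + d)%N (q * f)].

Lemma graded_sum s G d (I : Type) (r : seq I) (P : pred I) (F : I -> {mpoly C[n]}) :
    graded_ideal s G -> (forall i, P i -> G d (F i)) ->
  G d (\sum_(i <- r | P i) F i).
Proof. by case=> G0 GD _ GF; apply: big_ind => //; apply: GD. Qed.

Lemma graded_monomials s G d f : graded_ideal s G ->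
    (forall m, mdeg m = d -> (forall i, i \notin s -> m i = 0%N) -> G d 'X_[m]) ->
  hom_in s d f -> G d f.
Proof.
move=> grG GX hf; rewrite (mpolyE f) big_seq; apply: (graded_sum _ grG) => m /hf[dm sm].
rewrite -mul_mpolyC; case: grG => _ _ GM.
by rewrite -[d]add0n; apply: GM (GX _ _ _); first apply: hom_inC.
Qed.

Lemma graded_colon s G i : i \in s -> graded_ideal s G ->
  graded_ideal s (fun d f => G d.+1 ('X_i * f)).
Proof.
move=> si [G0 GD GM]; split=> [d|d f g|d e q f hq Gf]; first by rewrite mulr0.
  by rewrite mulrDr; apply: GD.
by rewrite -addnS mulrCA; apply: GM.
Qed.

(** The sum of [G] and the ideal of [x_i]. The cofactor [b] is kept homogeneous so that induction
    applies to it in degree [d - 1]; in degree 0 only [b = 0] remains. *)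
Lemma graded_add_var s G i : i \in s -> graded_ideal s G ->
  graded_ideal s (fun d f => exists b,
    (if d is e.+1 then hom_in s e b else b = 0) /\ G d (f - 'X_i * b)).
Proof.
move=> si [G0 GD GM]; split=> [d|d f g [b [hb Gb]] [c [hc Gc]]|d e q f hq [b [hb Gb]]].
- exists 0; split; first by case: d => // d; apply: hom_in0.
  by rewrite mulr0 subr0.
- exists (b + c); split; last by rewrite mulrDr opprD addrACA; apply: GD.
  by case: d hb hc {Gb Gc} => [-> ->|d hb hc]; [rewrite addr0 | apply: hom_inD].
- exists (q * b); split; last by rewrite mulrCA -mulrBr; apply: GM.
  case: d hb {Gb} => [->|d hb]; last by rewrite addnS; apply: hom_inM.
  by rewrite mulr0; case: (e + 0)%N => // k; apply: hom_in0.
Qed.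

(** For [i] outside [U], [h_(N+1)(x_i, x_s) = h_(N+1)(x_s) + x_i h_N(x_i, x_s)]. Cancelling these
    copies of [h_(N+1)(x_s)] in [sum_hsym_cons] leaves a positive integer multiple of it, which is
    divided out. *)
Lemma graded_hsym s (U : {set 'I_n}) G N : graded_ideal s G ->
    (forall i, i \in U -> G N.+1 (hsym ('X_i :: [seq 'X_j | j <- s]) N.+1)) ->
    (forall i, i \in s -> i \notin U -> G 1%N 'X_i) ->
  G N.+1 (hsym [seq 'X_j | j <- s] N.+1).
Proof.
move=> grG GU Gvar; case: (grG) => _ _ GM; set xs := map _ s in GU *.
rewrite -(natr_mpoly_invK (count (mem U) s + N) (hsym _ _)) -[N.+1]add0n.
apply: (GM); first exact: hom_inC.
have -> : (count (mem U) s + N).+1%:R * hsym xs N.+1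
   = \sum_(i <- s | i \in U) hsym ('X_i :: xs) N.+1
     + \sum_(i <- s | i \notin U) hsym ('X_i :: xs) N * 'X_i.
  have := sum_hsym_cons xs N.+1; rewrite big_map (bigID (mem U)) [LHS]/=.
  rewrite [X in _ + X = _](eq_bigr (fun i => hsym ('X_i :: xs) N * 'X_i + hsym xs N.+1)).
    rewrite big_split /= big_const_seq iter_addr_0 size_map.
    set c := count _ _; set c' := count (mem U) s => sumE.
    apply: (addIr (hsym xs N.+1 *+ c)); rewrite -addrA sumE.
    rewrite -[hsym xs N.+1 *+ c]mulr_natl -[LHS]mulrDl -natrD.
    have <- : (c' + c)%N = size s by apply: count_predC.
    by congr (_%:R * _); lia.
  by move=> i _; rewrite -/(hsym (_ :: _) _) hsym_consS mulrC addrC.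
case: (grG) => _ GD _; apply: GD.
  by apply: (graded_sum _ grG) => i iU; apply: GU.
rewrite big_seq_cond; apply: (graded_sum _ grG) => i /andP[si iU].
rewrite -addn1; apply: GM (Gvar i si iU).
by apply: (@hom_in_hsym s (i :: s)) => j; rewrite inE => /predU1P[->|].
Qed.

Lemma graded_vars s G d f : graded_ideal s G -> (forall i, i \in s -> G 1%N 'X_i) ->
  hom_in s d f -> (0 < d)%N -> G d f.
Proof.
move=> grG GX hf d_gt0; apply: (graded_monomials grG) hf => m dm sm.
have [i mi] : exists i, m i != 0%N.
  apply/existsP; apply: contraLR d_gt0 => /existsPn m0.
  rewrite -dm -leqNgt leqn0 mdeg_eq0.
  by apply/eqP/mnmP => i; rewrite mnm0E; apply/eqP; rewrite -[_ == _]negbK m0.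
have si : i \in s by apply: contraR mi => /sm ->.
have Dm : (m - U_(i) + U_(i))%MM = m by apply/submK; rewrite lep1mP.
case: grG => _ _ GM; have := mdegD (m - U_(i)) U_(i); rewrite Dm dm mdeg1 => ->.
have -> : 'X_[m] = 'X_[m - U_(i)] * 'X_i :> {mpoly C[n]} by rewrite -mpolyXD Dm.
apply: GM (GX i si); apply: hom_inX => // j sj.
by rewrite mnmBE sm.
Qed.

(* With [|U| = k], [A] empty and [G] an ordinary ideal this says that the
   ideal of [C[x_1..x_k]] generated by the partial derivatives
   [d h_(N+1) / dx_i = h_N(x_i, x_1, .., x_k)] contains all forms of degree
   greater than [k(N-1)].  The set [A] interpolates between [N] and [N-1],
   since [x_i h_(N-1)(x_i, x) = h_N(x_i, x) - h_N(x)] and [h_N] belongs to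
   the ideal by [graded_hsym]. *)
Lemma graded_vanish s N (U A : {set 'I_n}) G d f : graded_ideal s G ->
    A \subset U -> {subset U <= s} ->
    (forall i, i \in U -> G N (hsym ('X_i :: [seq 'X_j | j <- s]) N)) ->
    (forall i, i \in A -> G N.-1 (hsym ('X_i :: [seq 'X_j | j <- s]) N.-1)) ->
    (forall i, i \in s -> i \notin U -> G 1%N 'X_i) ->
    hom_in s d f -> (#|U| * N < d + #|U| + #|A|)%N ->
  G d f.
Proof.
set xs := map _ s.
elim: N U A G d f => [|N IHN] U A G d f grG sAU sUs GU GA Gvar hf ltd;
  case: (grG) => G0 GD GM; have [U0|[i0 i0U]] := set_0Vmem U.
- apply: (graded_vars grG) hf _ => [i si|]; last first.
    by have := subset_leq_card sAU; move: ltd; rewrite U0 cards0; lia.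
  by apply: Gvar => //; rewrite U0 inE.
- have := GU _ i0U; rewrite hsym0 => G1; rewrite -[f]mulr1 -[d]addn0.
  exact: GM hf G1.
- apply: (graded_vars grG) hf _ => [i si|]; last first.
    by have := subset_leq_card sAU; move: ltd; rewrite U0 cards0; lia.
  by apply: Gvar => //; rewrite U0 inE.
(* Inner induction on the number of elements of [U] not yet in [A]; once [A = U], the index [N.+1]
   drops to [N] and [A] restarts empty. *)
move: {2}#|U :\: A| (erefl #|U :\: A|) => c.
elim: c U A G d f grG sAU sUs GU GA Gvar hf ltd {G0 GD GM i0 i0U}
    => [|c IHc] U A G d f grG sAU sUs GU GA Gvar hf ltd Dc.
  have eAU : A = U by apply/eqP; rewrite eqEsubset sAU -setD_eq0 -cards_eq0 Dc.
  apply: (IHN U set0) => //; rewrite ?sub0set -?eAU //.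
    by move=> i; rewrite inE.
  by rewrite cards0; move: ltd; rewrite eAU mulnS; lia.
have [i] : exists i, i \in U :\: A by apply/set0Pn; rewrite -card_gt0 Dc.
rewrite inE => /andP[iA iU]; have si := sUs _ iU; case: (grG) => G0 GD GM.
have cU := cardsD1 i U; rewrite iU add1n in cU.
have cUA : #|(U :\: A) :\ i| = c.
  by have := cardsD1 i (U :\: A); rewrite inE iA iU Dc => -[].
have grA := graded_add_var si grG; have grC := graded_colon si grG.
(* In the sum with [x_i] the variable leaves [U], so induction writes [f] as [x_i b] modulo [G]. *)
have [b [hb Gb]] : exists b, (if d is e.+1 then hom_in s e b else b = 0)
                          /\ G d (f - 'X_i * b).
  have incl e g : G e g -> exists b : {mpoly C[n]},
      (if e is e'.+1 then hom_in s e' b else b = 0) /\ G e (g - 'X_i * b).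
    by exists 0; rewrite mulr0 subr0; split=> //; case: (e) => // ?; apply: hom_in0.
  apply: (IHc (U :\ i) A _ d f grA) => //.
  - by rewrite subsetD1 sAU.
  - by move=> j; rewrite inE => /andP[_ /sUs].
  - by move=> j; rewrite inE => /andP[_ /GU]; apply: incl.
  - by move=> j /GA; apply: incl.
  - move=> j sj; rewrite !inE negb_and negbK.
    case/predU1P=> [->|/(Gvar j sj)]; last exact: incl.
    by exists 1; rewrite mulr1 subrr; split=> //; apply: hom_inC.
  - by move: ltd; rewrite cU; lia.
  - by rewrite setDDl setUC -setDDl.
rewrite -[f](subrK ('X_i * b)); apply: (GD) => //.
case: d hb {Gb hf} ltd => [-> _|d hb ltd]; first by rewrite mulr0.
have shift e g : G e g -> G e.+1 ('X_i * g).
  by rewrite -add1n; apply: (GM); apply: hom_in_var.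
(* In the colon ideal by [x_i], [i] joins [A]; the larger [#|A|] balances the lower degree of
   [b]. *)
apply: (IHc U (i |: A) _ d b grC) => //.
- by rewrite subUset sub1set iU.
- by move=> j /GU; apply: shift.
- move=> j; rewrite !inE => /predU1P[->|/GA]; last exact: shift.
  have -> : 'X_i * hsym ('X_i :: xs) N = hsym ('X_i :: xs) N.+1 - hsym xs N.+1.
    by rewrite hsym_consS addrC addKr.
  apply: (GD); first exact: GU.
  rewrite -mulN1r -[N.+1]add0n; apply: (GM).
    by rewrite -mpolyC1 -mpolyCN; apply: hom_inC.
  exact: graded_hsym grG GU Gvar.
- by move=> j sj /(Gvar j sj); apply: shift.
- by rewrite cardsU1 iA; move: ltd; lia.
- by rewrite setUC -setDDl.
Qed.
End HomogeneousIn.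

(** * Degree bounds when variables are added *)

Section IdealVanish.
Variables (C : numFieldType) (n : nat) (G : {mpoly C[n]} -> Prop).
Hypothesis idG : ideal_pred G.

(* The relation [h_(M+1)(x_t, x_s)] is monic of degree [M+1] in [x_t]. *)
Lemma vanish_cons (s : seq 'I_n) t D M k :
    (forall d f, hom_in s d f -> (D < d + k)%N -> G f) ->
    G (hsym ('X_t :: [seq 'X_i | i <- s]) M.+1) ->
  forall d f, hom_in (t :: s) d f -> (D + M < d + k)%N -> G f.
Proof.
set xs := map _ s => Gs Gh d f hf ltd.
(* Powers [x_t^a] with [a > M] are reduced by the monic relation, which lowers [a] and preserves the
   total degree [a + e]. *)
have Gv a e v : hom_in s e v -> (D + M < a + e + k)%N -> G ('X_t ^+ a * v).
  elim/ltn_ind: a e v => a IHa e v hv lte.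
  have [le_aM | lt_Ma] := leqP a M.
    by apply: ideal_predMl => //; apply: Gs hv _; lia.
  have Da : a = (a - M.+1 + M.+1)%N by lia.
  have -> : 'X_t ^+ a * v = 'X_t ^+ (a - M.+1) * v * hsym ('X_t :: xs) M.+1
     - \sum_(b < M.+1) 'X_t ^+ (a - M.+1 + b) * (hsym xs (M.+1 - b) * v).
    have -> : \sum_(b < M.+1) 'X_t ^+ (a - M.+1 + b) * (hsym xs (M.+1 - b) * v)
        = 'X_t ^+ (a - M.+1) * v * \sum_(b < M.+1) 'X_t ^+ b * hsym xs (M.+1 - b).
      by rewrite mulr_sumr; apply: eq_bigr => b _; rewrite exprD; ring.
    rewrite hsym_cons big_ord_recr /= subnn hsym0 mulr1 mulrDr addrAC subrr add0r.
    by rewrite {1}Da exprD mulrAC.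
  apply: ideal_predB => //; first by apply: ideal_predMl.
  apply: ideal_pred_sum => // b _; have := ltn_ord b; rewrite ltnS => le_bM.
  apply: (IHa _ _ (M.+1 - b + e)%N); try lia.
  by apply: hom_inM hv; apply: hom_in_hsym.
rewrite (mpolyE f) big_seq; apply: ideal_pred_sum => // m /hf [dm sm].
rewrite -mul_mpolyC; apply: ideal_predMl => //.
pose m' := (m - U_(t) *+ m t)%MM.
have Dm : m = (U_(t) *+ m t + m')%MM.
  apply/mnmP => i; rewrite mnmDE mnmBE mulmnE mnm1E; case: eqP => [<-|_] /=; lia.
rewrite Dm mpolyXD -mpolyXn; apply: (Gv _ (mdeg m')).
  apply: hom_inX => // i si; rewrite mnmBE mulmnE mnm1E.
  case: eqP => [<-|/eqP ti] /=; first lia.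
  by rewrite sm // inE negb_or eq_sym ti.
by move: ltd; rewrite -dm {1}Dm mdegD mdegMn mdeg1 mul1n.
Qed.

Hypothesis Gp : forall j, (0 < j <= n)%N -> G (\sum_(i < n) 'X_i ^+ j).

(** Adding a variable to [r] others uses a relation of degree [n - r] and raises the bound by
    [n - r - 1]. The increments telescope to the difference of the two binomials, stated additively
    to avoid truncated subtraction. *)
Lemma vanish_cat (s ts : seq 'I_n) D k :
    uniq (ts ++ s) ->
    (forall d f, hom_in s d f -> (D < d + k)%N -> G f) ->
  forall d f, hom_in (ts ++ s) d f ->
    (D + 'C(n - size s, 2) < d + k + 'C(n - size s - size ts, 2))%N -> G f.
Proof.
move=> + Gs; elim: ts => [|t ts IHts] /= uts d f hf ltd.
  by apply: Gs hf _; move: ltd; rewrite subn0; lia.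
have [_ uts'] := andP uts.
have lts : ((size ts + size s).+1 <= n)%N.
  have : (size (t :: ts ++ s) <= size (enum 'I_n))%N.
    by apply: uniq_leq_size => // i _; rewrite mem_enum.
  by rewrite size_enum_ord /= size_cat.
pose M := (n - size s - (size ts).+1)%N.
have DM : (n - size s - size ts)%N = M.+1 by rewrite /M; lia.
apply: (@vanish_cons (ts ++ s) t (D + 'C(n - size s, 2)) M (k + 'C(M.+1, 2)) _ _ d f hf).
- by move=> e g hg lte; apply: (IHts uts' e g hg); rewrite DM addnA in lte *.
- apply: (@hsym_in_power_sum_ideal C n G idG Gp (t :: ts ++ s)) => //=;
    rewrite ?size_cat /M; lia.
- by move: ltd; rewrite -/M binS bin1; lia.
Qed.

End IdealVanish.

(** * The ideal of differential forms *)

Section Forms.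
Variables (C : numFieldType) (n : nat).
Implicit Types (S A B : {set 'I_n}) (w a b : pform C n) (q f : {mpoly C[n]}).

(* [dx_A /\ dx_t = eps A t * dx_(A + t)] for [t] outside [A]. *)
Definition eps A (t : 'I_n) : {mpoly C[n]} := (-1) ^+ #|[set a in A | (t < a)%N]|.

Definition mono S f : pform C n := [ffun B => if B == S then f else 0].

Lemma wedgeE a b S :
  wedge a b S = \sum_(B : {set 'I_n} | B \subset S)
    wsign C (S :\: B) B * a (S :\: B) * b B.
Proof.
rewrite ffunE (exchange_big_dep predT) //= [RHS]big_mkcond; apply: eq_bigr => B _.
case: ifPn => [sBS | nsBS]; last first.
  by rewrite big_pred0 // => A; apply: contraNF nsBS => /andP[_ /eqP<-]; apply: subsetUr.
rewrite (big_pred1 (S :\: B)) // => A /=; apply/andP/eqP => [[/eqP AB0 /eqP <-]|->].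
  by rewrite setDUl setDv setU0; apply/esym/setDidPl; rewrite -setI_eq0 AB0.
split; last by rewrite setUC -{1}(setIidPr sBS) setID.
by apply/eqP/setP => x; rewrite !inE andbAC andNb.
Qed.

Lemma wedge_psum a j S : wedge a (psum C n j) S = a S * \sum_(i < n) 'X_i ^+ j.
Proof.
rewrite wedgeE (bigD1 set0) ?sub0set //= big1 ?addr0 => [|B /andP[_ /negPf B0]].
  rewrite setD0 /psum /form0 ffunE eqxx /wsign.
  rewrite (_ : [set _ | _] = set0) ?cards0 ?expr0 ?mul1r //.
  by apply/setP=> ij; rewrite !inE andbF.
by rewrite /psum /form0 ffunE B0 mulr0.
Qed.

Lemma dform_psum j B :
  dform (psum C n j) B = \sum_i if B == [set i] then j%:R * 'X_i ^+ j.-1 else 0.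
Proof.
rewrite ffunE big_mkcond; apply: eq_bigr => i _; rewrite /psum /form0 ffunE.
have [->|neqB] := eqVneq B [set i].
  rewrite set11 setDv eqxx raddf_sum (bigD1 i) //= big1 => [|l li].
    rewrite (_ : [set _ in _ | _] = set0) ?cards0 ?mul1r; last first.
      by apply/setP=> l; rewrite !inE; case: eqP => // ->; rewrite ltnn.
    rewrite addr0 mpolyXn mderivX mulmnE mnm1E eqxx mul1n scaler_nat mulr_natl.
    by case: j => [|j]; rewrite ?mulr0n // mpolyXn mulmS addmC addmK.
  by rewrite mpolyXn mderivX mulmnE mnm1E (negPf li) scale0r.
case: ifP => // iB; case: ifP => [/eqP B0|]; last by rewrite mderiv0 mulr0.
by case/eqP: neqB; rewrite -(setD1K iB) B0 setU0.
Qed.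

Lemma wedge_dpsum b j S : wedge b (dform (psum C n j)) S
  = \sum_(i in S) eps (S :\ i) i * b (S :\ i) * (j%:R * 'X_i ^+ j.-1).
Proof.
rewrite wedgeE; under eq_bigr => B _ do rewrite dform_psum mulr_sumr.
rewrite exchange_big /= [RHS]big_mkcond; apply: eq_bigr => i _.
rewrite big_mkcond (bigD1 [set i]) //= big1 ?addr0 => [|B /negPf ->]; last first.
  by rewrite mulr0 if_same.
rewrite sub1set eqxx; case: ifP => // iS; congr (_ * _ * _).
rewrite /wsign /eps; congr (_ ^+ _).
rewrite -(card_imset _ (_ : injective (fun a : 'I_n => (a, i)))); last by move=> x y [].
apply: eq_card => -[x y]; rewrite !inE; apply/idP/imsetP.
  case/andP=> /andP[/= xS /eqP ->] lt_ix; exists x => //.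
  by rewrite !inE xS.
by case=> z; rewrite !inE => zS [-> ->] /=; move: zS; rewrite eqxx andbT.
Qed.

End Forms.
Section InI.
Variables (C : numFieldType) (n : nat).
Implicit Types (S A B : {set 'I_n}) (w a b : pform C n) (q f : {mpoly C[n]}).

Lemma eps_sqr A (t : 'I_n) : eps C A t * eps C A t = 1.
Proof. by rewrite -expr2 sqrr_sign. Qed.

Lemma in_IP w : in_I w <-> exists a b : nat -> pform C n, forall S,
  w S = \sum_(1 <= j < n.+1) (a j S * (\sum_(i < n) 'X_i ^+ j)
     + \sum_(i in S) eps C (S :\ i) i * b j (S :\ i) * (j%:R * 'X_i ^+ j.-1)).
Proof.
split=> -[a [b wE]]; exists a, b; last apply/ffunP; move=> S.
  by rewrite wE sum_ffunE; apply: eq_bigr => j _; rewrite ffunE wedge_psum wedge_dpsum.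
by rewrite wE sum_ffunE; apply: eq_bigr => j _; rewrite ffunE wedge_psum wedge_dpsum.
Qed.

Lemma in_I0 : in_I (0 : pform C n).
Proof.
apply/in_IP; exists (fun=> 0), (fun=> 0) => S; rewrite ffunE big1 // => j _.
by rewrite /= ?ffunE mul0r big1 ?addr0 // => i _; rewrite ffunE mulr0 mul0r.
Qed.

Lemma in_ID w w' : in_I w -> in_I w' -> in_I (w + w').
Proof.
move=> /in_IP[a [b wE]] /in_IP[a' [b' wE']]; apply/in_IP.
exists (fun j => a j + a' j), (fun j => b j + b' j) => S.
rewrite ffunE wE wE' -big_split; apply: eq_bigr => j _ /=.
rewrite ffunE mulrDl addrACA -big_split; congr (_ + _); apply: eq_bigr => i _ /=.
by rewrite ffunE mulrDr mulrDl.
Qed.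

Lemma in_I_scale q w : in_I w -> in_I [ffun S => q * w S].
Proof.
move=> /in_IP[a [b wE]]; apply/in_IP.
exists (fun j => [ffun S => q * a j S]), (fun j => [ffun S => q * b j S]) => S.
rewrite ffunE wE mulr_sumr; apply: eq_bigr => j _.
rewrite ffunE mulrDr mulrA; congr (_ + _); rewrite mulr_sumr; apply: eq_bigr => i _.
by rewrite ffunE !mulrA [q * _]mulrC.
Qed.

Lemma in_I_sum (I : Type) (r : seq I) (P : pred I) (F : I -> pform C n) :
  (forall i, P i -> in_I (F i)) -> in_I (\sum_(i <- r | P i) F i).
Proof. by move=> hF; apply: big_ind => //; [apply: in_I0 | apply: in_ID]. Qed.

Lemma wedge0psum j : wedge 0 (psum C n j) = 0.
Proof. by apply/ffunP => S; rewrite wedge_psum ?ffunE mul0r. Qed.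

Lemma wedge0dpsum j : wedge 0 (dform (psum C n j)) = 0.
Proof.
apply/ffunP => S; rewrite wedge_dpsum big1 ?ffunE // => i _.
by rewrite ffunE mulr0 mul0r.
Qed.

Lemma in_I_dpsum b j : (0 < j <= n)%N -> in_I (wedge b (dform (psum C n j))).
Proof.
move=> j_n; exists (fun=> 0), (fun l => if l == j then b else 0).
case: j j_n => // j j_n; rewrite big_add1 big_mkord (bigD1 (Ordinal j_n)) //= eqxx.
rewrite wedge0psum add0r big1 ?addr0 // => l; rewrite -val_eqE eqSS /= => /negPf ->.
by rewrite wedge0psum wedge0dpsum addr0.
Qed.

Lemma in_I_psum a j : (0 < j <= n)%N -> in_I (wedge a (psum C n j)).
Proof.
move=> j_n; exists (fun l => if l == j then a else 0), (fun=> 0).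
case: j j_n => // j j_n; rewrite big_add1 big_mkord (bigD1 (Ordinal j_n)) //= eqxx.
rewrite wedge0dpsum addr0 big1 ?addr0 // => l; rewrite -val_eqE eqSS /= => /negPf ->.
by rewrite wedge0psum wedge0dpsum addr0.
Qed.

Lemma mono_ideal S : ideal_pred (fun f => in_I (mono S f)).
Proof.
split=> [|f g If Ig|q f If].
- suff -> : mono S (0 : {mpoly C[n]}) = 0 by apply: in_I0.
  by apply/ffunP => B; rewrite !ffunE if_same.
- suff -> : mono S (f + g) = mono S f + mono S g by apply: in_ID.
  by apply/ffunP => B; rewrite !ffunE; case: ifP; rewrite ?addr0.
- suff -> : mono S (q * f) = [ffun B => q * mono S f B] by apply: in_I_scale.
  by apply/ffunP => B; rewrite !ffunE; case: ifP; rewrite ?mulr0.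
Qed.

Lemma mono_psum S j : (0 < j <= n)%N ->
  in_I (mono S (\sum_(i < n) 'X_i ^+ j : {mpoly C[n]})).
Proof.
move=> j_n; suff -> : mono S (\sum_(i < n) 'X_i ^+ j) = wedge (mono S 1) (psum C n j).
  exact: in_I_psum.
by apply/ffunP => B; rewrite wedge_psum !ffunE; case: ifP; rewrite ?mul1r ?mul0r.
Qed.

(* For [eta = dx_(S - i)], the combination
   [\sum_a h_(n-k-a)(x_S) dp_(a+1) /\ eta / (a+1)] of the generators equals
   [\sum_t h_(n-k)(x_t, x_S) dx_t /\ eta]; its terms with [t] in [S - i]
   vanish and those with [t] outside [S] have coefficients in the ideal of
   the power sums, which leaves the term [t = i]. *)
Lemma mono_hsym S i : i \in S ->
  in_I (mono S (hsym ('X_i :: [seq ('X_j : {mpoly C[n]}) | j <- enum S]) (n - #|S|))).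
Proof.
move=> iS; set xs := map _ _; set N := (n - _)%N; pose A := S :\ i.
have iA : i \notin A by rewrite !inE eqxx.
have S_gt0 : (0 < #|S|)%N by apply/card_gt0P; exists i.
have le_Sn : (#|S| <= n)%N by rewrite -[n in leqRHS]card_ord max_card.
pose T t := mono (t |: A) (eps C A t * hsym ('X_t :: xs) N).
pose tau := \sum_(a < N.+1)
  wedge (mono A (hsym xs (N - a) * (a.+1%:R^-1)%:MP)) (dform (psum C n a.+1)).
have Itau : in_I tau.
  by apply: in_I_sum => a _; apply: in_I_dpsum; have := ltn_ord a; rewrite /N; lia.
have tauE : tau = \sum_(t | t \notin A) T t.
  apply/ffunP => B; rewrite !sum_ffunE.
  under eq_bigr do rewrite wedge_dpsum.
  rewrite exchange_big big_mkcond [RHS]big_mkcond /=; apply: eq_bigr => t _.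
  have [tB|tB] := boolP (t \in B); last first.
    case: ifP => // _; rewrite ffunE; case: eqP => // BtA.
    by rewrite BtA setU11 in tB.
  have [BtA|neqBA] := eqVneq (B :\ t) A; last first.
    rewrite big1 => [|a _]; last by rewrite ffunE (negPf neqBA) mulr0 mul0r.
    case: ifP => // tA; rewrite ffunE; case: eqP => // BtA.
    by rewrite BtA setU1K ?eqxx in neqBA.
  have tA : t \notin A by rewrite -BtA setD11.
  rewrite tA ffunE -BtA setD1K // eqxx hsym_cons mulr_sumr.
  apply: eq_bigr => a _; rewrite ffunE eqxx -mulrA; congr (_ * _).
  rewrite -[RHS](natr_mpoly_invK a); ring.
have IT t : t \notin S -> in_I (T t).
  move=> tS; apply: (ideal_predMl (mono_ideal _)).
  apply: (@hsym_in_power_sum_ideal C n _ (mono_ideal _) (@mono_psum _) (t :: enum S)).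
  - by rewrite /= mem_enum tS enum_uniq.
  - have lt_Sn : (#|S| < n)%N.
      by have := max_card (mem (t |: S)); rewrite card_ord cardsU1 tS.
    have szS : size (enum S) = #|S| by rewrite cardE.
    by rewrite /= szS /N; lia.
  - by rewrite /N; lia.
have ITi : in_I (T i).
  move: Itau; rewrite tauE (bigD1 i) //= => /in_ID; set w := \sum_(t | _) T t.
  have /(in_I_scale (-1)) Iw : in_I w.
    apply: in_I_sum => t /andP[tA ti]; apply: IT; apply: contra tA => tS.
    by rewrite !inE ti.
  move=> /(_ _ Iw); congr in_I; apply/ffunP => B.
  by rewrite !ffunE mulN1r addrK.
rewrite -[hsym _ _]mul1r -(eps_sqr A i) -mulrA.
by apply: (ideal_predMl (mono_ideal S)); rewrite /T setD1K in ITi.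
Qed.

End InI.

(** * Forms above the critical degree *)

Lemma bin2D a b : 'C(a + b, 2) = ('C(a, 2) + 'C(b, 2) + a * b)%N.
Proof.
elim: b => [|b IHb]; first by rewrite addn0 muln0 !addn0.
by rewrite addnS !binS !bin1 IHb mulnS; lia.
Qed.

Section UpperBound.
Variables (C : numFieldType) (n : nat).
Implicit Types (S : {set 'I_n}) (w : pform C n) (f : {mpoly C[n]}).

Lemma mono_in_I S f l : f \is l.-homog ->
  ('C(n, 2) < l + 'C(#|S|.+1, 2))%N -> in_I (mono S f).
Proof.
move=> hf ltl; have idS := @mono_ideal C n S; have [id0 idD idM] := idS.
have szS : size (enum S) = #|S| by rewrite cardE.
have szC : size (enum (~: S)) = (n - #|S|)%N.
  by rewrite -cardE cardsCs setCK card_ord.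
have le_Sn : (#|S| <= n)%N by rewrite -[n in leqRHS]card_ord max_card.
have vanS d (g : {mpoly C[n]}) :
    hom_in (enum S) d g -> (#|S| * (n - #|S|) < d + #|S|)%N -> in_I (mono S g).
  move=> hg ltd; pose G (_ : nat) (q : {mpoly C[n]}) := in_I (mono S q).
  suff: G d g by [].
  apply: (@graded_vanish C n (enum S) (n - #|S|) S set0) hg _ => //.
  - by split=> [e|e|e e' q h _]; [apply: id0 | apply: idD | apply: idM].
  - exact: sub0set.
  - by move=> i; rewrite mem_enum.
  - by move=> i iS; apply: mono_hsym.
  - by move=> i; rewrite inE.
  - by move=> i; rewrite mem_enum => ->.
  - by rewrite cards0 addn0.
have uTS : uniq (enum (~: S) ++ enum S).
  rewrite cat_uniq !enum_uniq andbT; apply/hasPn => i.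
  by rewrite !mem_enum inE negbK.
apply: (vanish_cat idS (@mono_psum C n S) uTS vanS (d := l)).
  move=> m mf; split; first exact: (dhomog_mf hf).
  by move=> i; rewrite mem_cat !mem_enum inE orNb.
(* With [k = #|S|]: [C(n, 2) = C(k, 2) + C(n - k, 2) + k (n - k)] and [C(k+1, 2) = C(k, 2) + k]. *)
rewrite szS szC subnn; move: ltl; rewrite -{1}(subnKC le_Sn) bin2D binS bin1.
by lia.
Qed.

Lemma in_I_large_degree k l w :
  ('C(n, 2) < l + 'C(k.+1, 2))%N -> in_Omega l k w -> in_I w.
Proof.
move=> ltl Ow; have -> : w = \sum_S mono S (w S).
  apply/ffunP => B; rewrite sum_ffunE (bigD1 B) //= big1 => [|S /negPf SB].
    by rewrite addr0 ffunE eqxx.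
  by rewrite ffunE eq_sym SB.
apply: in_I_sum => S _; have [wS wS0] := Ow S.
have [Sk|/eqP Sk] := eqVneq #|S| k; first by apply: mono_in_I wS _; rewrite Sk.
by rewrite (wS0 (introN eqP Sk)); case: (@mono_ideal C n S).
Qed.
End UpperBound.

(** * The pairing with theta *)

Section Contraction.
Variables (C : numFieldType) (n : nat).
Implicit Types (S T A : {set 'I_n}) (w : pform C n).

(* Coefficient of [dx_S] in [theta_1 /\ .. /\ theta_k],
   where [theta_m = \sum_t x_t^m dx_t]. *)
Fixpoint theta k S : {mpoly C[n]} :=
  if k is k'.+1 then \sum_(t in S) eps C (S :\ t) t * 'X_t ^+ k * theta k' (S :\ t)
  else (S == set0)%:R.

(** For the coefficientwise pairing, the adjoint of right multiplication by
    [\sum_t x_t^j dx_t = dp_(j+1) / (j+1)], applied to [theta k]. *)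
Definition contraction k j T : {mpoly C[n]} :=
  \sum_(t | t \notin T) eps C T t * 'X_t ^+ j * theta k (t |: T).

Lemma epsU1 A t u : t \notin A -> eps C (t |: A) u = (-1) ^+ (u < t)%N * eps C A u.
Proof.
move=> tA; rewrite /eps -exprD; congr (_ ^+ _); set X := [set a in A | _].
have [ut|tu] := boolP (u < t)%N.
  have tX : t \notin X by rewrite inE (negPf tA).
  have -> : (true + #|X|)%N = #|t |: X| by rewrite cardsU1 tX.
  by apply: eq_card => a; rewrite !inE; case: eqVneq => // ->.
rewrite add0n; apply: eq_card => a; rewrite !inE.
by case: eqVneq => // ->; rewrite (negPf tu) !andbF.
Qed.

(** The anticommutation of [dx_t] and [dx_u] in terms of [eps]: exactly one of [t < u] and [u < t]
    holds. *)
Lemma eps_swap A t u : t \notin A -> u \notin A -> t != u ->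
  eps C (u |: A) t * eps C (t |: A) u = - (eps C A u * eps C A t).
Proof.
move=> tA uA tu; rewrite !epsU1 //.
have : ((-1) ^+ (t < u)%N * (-1) ^+ (u < t)%N : {mpoly C[n]}) = -1.
  by case: (ltngtP t u) tu => [_ _|_ _|/val_inj ->]; rewrite ?eqxx // ?mulr1 ?mul1r expr1.
by move=> E; rewrite mulrACA E mulN1r [eps C A t * _]mulrC.
Qed.

(* Contraction with the vector field [\sum_t x_t^j d/dx_t] is an antiderivation
   which maps [theta_m] to the power sum of exponent [j + m]. *)
Lemma contractionS k j T :
  contraction k.+1 j T = (\sum_(t < n) 'X_t ^+ (j + k.+1)) * theta k T
    - \sum_(u in T) eps C (T :\ u) u * 'X_u ^+ k.+1 * contraction k j (T :\ u).
Proof.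
have termE t : t \notin T -> eps C T t * 'X_t ^+ j * theta k.+1 (t |: T)
  = 'X_t ^+ (j + k.+1) * theta k T + \sum_(u in T) eps C T t * 'X_t ^+ j *
       (eps C (t |: (T :\ u)) u * 'X_u ^+ k.+1 * theta k (t |: (T :\ u))).
  move=> tT; rewrite /= big_setU1 //= setU1K // mulrDr mulr_sumr; congr (_ + _).
    rewrite exprD -[RHS]mul1r -(eps_sqr C T t); ring.
  apply: eq_bigr => u uT; suff -> : (t |: T) :\ u = t |: (T :\ u) by [].
  apply/setP => x; rewrite !inE; have [-> | //] := eqVneq x t.
  by rewrite /= andbT; apply: contraNneq tT => ->.
rewrite /contraction (eq_bigr _ termE) big_split /= exchange_big /=.
(* The terms of the power sum with [t] in [T] are absent on the left; each cancels the term [t = u]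
   of [contraction k j (T :\ u)]. *)
rewrite mulr_suml [in RHS](bigID (mem T)) /= [X in _ = X - _]addrC -addrA.
congr (_ + _); rewrite -sumrB; apply: eq_bigr => u uT.
have uTu : u \notin T :\ u by rewrite setD11.
rewrite [X in _ = _ - _ * X](bigD1 u) //= setD1K //.
rewrite (eq_bigl (fun t => (t \notin T :\ u) && (t != u))); last first.
  move=> t; rewrite !inE negb_and negbK.
  by have [->|_] := eqVneq t u; rewrite ?uT ?andbT.
rewrite mulrDr opprD addrA.
have -> : 'X_u ^+ (j + k.+1) * theta k T - eps C (T :\ u) u * 'X_u ^+ k.+1 *
    (eps C (T :\ u) u * 'X_u ^+ j * theta k T) = 0.
  by rewrite exprD -[X in X - _]mul1r -(eps_sqr C (T :\ u) u); ring.
rewrite add0r mulr_sumr -sumrN; apply: eq_bigr => t /andP[tTu tu].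
have := eps_swap tTu uTu tu; rewrite setD1K // => E.
transitivity (eps C T t * eps C (t |: T :\ u) u
                * ('X_t ^+ j * 'X_u ^+ k.+1 * theta k (t |: (T :\ u)))); first by ring.
by rewrite E; ring.
Qed.

(** Induction by [contractionS], as [theta 0] is supported on the empty set. All positive exponents
    are asked for, since [j + k] can exceed [n]. *)
Lemma contraction_in_ideal (G : {mpoly C[n]} -> Prop) k j T : ideal_pred G ->
  (forall l, (0 < l)%N -> G (\sum_(i < n) 'X_i ^+ l)) -> G (contraction k j T).
Proof.
move=> idG Gp; elim: k T => [|k IHk] T.
  apply: ideal_pred_sum => // t _; have /negPf tT : t |: T != set0.
    by apply/set0Pn; exists t; rewrite setU11.
  by rewrite /= tT mulr0; case: idG.
rewrite contractionS; apply: ideal_predB => //.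
  by apply: (ideal_predMr idG); apply: Gp; rewrite addnS.
by apply: ideal_pred_sum => // u _; apply: (ideal_predMl idG).
Qed.

Lemma theta_pairing_in_ideal (G : {mpoly C[n]} -> Prop) k w : ideal_pred G ->
    (forall l, (0 < l)%N -> G (\sum_(i < n) 'X_i ^+ l)) ->
  in_I w -> G (\sum_S w S * theta k S).
Proof.
move=> idG Gp /in_IP[a [b wE]].
under eq_bigr do rewrite wE mulr_suml.
rewrite exchange_big big_nat; apply: ideal_pred_sum => // j /andP[j_gt0 _].
under eq_bigr do rewrite mulrDl; rewrite big_split; case: (idG) => _ GD _; apply: GD.
  by apply: ideal_pred_sum => // S _; rewrite mulrAC;
    apply: (ideal_predMl idG); apply: Gp.
suff -> : \sum_(S : {set 'I_n}) (\sum_(i in S) eps C (S :\ i) i * b j (S :\ i) *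
      (j%:R * 'X_i ^+ j.-1)) * theta k S
    = \sum_(T : {set 'I_n}) b j T * j%:R * contraction k j.-1 T.
  apply: ideal_pred_sum => // T _; apply: ideal_predMl => //.
  exact: contraction_in_ideal.
under eq_bigr do rewrite mulr_suml; under [RHS]eq_bigr do rewrite mulr_sumr.
rewrite (exchange_big_dep predT) //= [RHS](exchange_big_dep predT) //=.
apply: eq_bigr => i _.
(* Adjointness: pairs with [i \in S] correspond to pairs with [i \notin T] by [S = i |: T]. *)
rewrite (reindex_onto (fun T => i |: T) (fun S => S :\ i)) => [|S iS]; last exact: setD1K.
rewrite [LHS](eq_bigl (fun T => i \notin T)) => [|T]; last first.
  rewrite setU11 /=; have [iT|iT] := boolP (i \in T); last by rewrite setU1K ?eqxx.
  by apply: contraTF iT => /eqP <-; rewrite setD11.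
by apply: eq_bigr => T iT; rewrite setU1K //; ring.
Qed.
End Contraction.

(** * The antisymmetrization functional *)

Section Antisymmetrizer.
Variables (C : numFieldType) (n : nat).
Implicit Types (f g q : {mpoly C[n]}) (m : 'X_{1..n}) (s : 'S_n) (S : {set 'I_n}).

Definition perm_mnm s : 'X_{1..n} := [multinom (s i : nat) | i < n].

(* Coefficient of [\prod_i x_i^i] in the antisymmetrization. *)
Definition alt_coef f : C := \sum_(s : 'S_n) (-1) ^+ s * f@_(perm_mnm s).

Lemma alt_coefD f g : alt_coef (f + g) = alt_coef f + alt_coef g.
Proof. by rewrite -big_split; apply: eq_bigr => s _; rewrite mcoeffD mulrDr. Qed.

Lemma alt_coefZ c f : alt_coef (c *: f) = c * alt_coef f.
Proof. by rewrite mulr_sumr; apply: eq_bigr => s _; rewrite mcoeffZ mulrCA. Qed.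

Lemma alt_coef0 : alt_coef 0 = 0.
Proof. by apply: big1 => s _; rewrite mcoeff0 mulr0. Qed.

Lemma alt_coef_sum (I : Type) (r : seq I) (F : I -> {mpoly C[n]}) :
  alt_coef (\sum_(i <- r) F i) = \sum_(i <- r) alt_coef (F i).
Proof. exact: (big_morph alt_coef alt_coefD alt_coef0). Qed.

Lemma mcoeff_mulXn f (i : 'I_n) j m :
  (f * 'X_i ^+ j)@_m = if (j <= m i)%N then f@_(m - U_(i) *+ j) else 0.
Proof.
rewrite mpolyXn; case: ifP => [le_jm | lt_mj].
  have Dm : m = (U_(i) *+ j + (m - U_(i) *+ j))%MM.
    apply/mnmP => l; rewrite mnmDE mnmBE mulmnE mnm1E; case: eqP => [<-|_] /=; lia.
  by rewrite {1}Dm mcoeffMX.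
apply: memN_msupp_eq0; apply/negP; rewrite (perm_mem (msuppMX _ _)) => /mapP[m' _ Dm].
by move: lt_mj; rewrite Dm mnmDE mulmnE mnm1E eqxx mul1n leq_addr.
Qed.

(* Lowering the exponent [c] to [c - j] duplicates the exponent [c - j]. *)
Lemma alt_coef_psum q j : (0 < j)%N -> alt_coef (q * \sum_(i < n) 'X_i ^+ j) = 0.
Proof.
move=> j_gt0; pose lower (c : 'I_n) s : 'X_{1..n} :=
  [multinom (if s i == c then c - j else s i)%N | i < n].
have -> : alt_coef (q * \sum_(i < n) 'X_i ^+ j)
    = \sum_(c < n | (j <= c)%N) \sum_(s : 'S_n) (-1) ^+ s * q@_(lower c s).
  rewrite exchange_big; apply: eq_bigr => s _ /=.
  rewrite mulr_sumr raddf_sum /= mulr_sumr [RHS]big_mkcond.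
  rewrite (reindex_inj (@perm_inj _ s^-1)).
  apply: eq_bigr => c _; rewrite mcoeff_mulXn mnmE permKV.
  case: ifP => [le_jc|]; last by rewrite mulr0.
  congr (_ * _@_ _); apply/mnmP => i; rewrite mnmBE mulmnE mnm1E !mnmE.
  rewrite -[X in (X * j)%N]/(((s^-1)%g c == i) : nat) -(inj_eq (@perm_inj _ s)) permKV.
  rewrite eq_sym.
  by case: eqP => [->|_]; rewrite ?mul1n ?subn0.
apply: big1 => c le_jc; have lt_cj : (c - j < n)%N by have := ltn_ord c; lia.
(* Exchanging the values [c] and [c - j] preserves [lower c s], where both become [c - j], and
   reverses the sign. *)
pose t := tperm c (Ordinal lt_cj).
have odd_t : odd_perm t by rewrite odd_tperm -val_eqE /=; lia.
set sgsum := \sum_s _; suff E : sgsum = - sgsum.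
  by apply/eqP; rewrite -eqNr -E.
rewrite {1}/sgsum (reindex_inj (mulIg t)) -sumrN; apply: eq_bigr => s _ /=.
rewrite odd_permM odd_t addbT signrN mulNr; congr (- (_ * _@_ _)).
apply/mnmP => i; rewrite !mnmE permM /t.
by case: tpermP => [->|->|/eqP/negPf -> _] //=; rewrite ?eqxx // -val_eqE /=; case: eqP.
Qed.

(** The largest ideal inside the kernel of [alt_coef], to which the statements about ideals
    apply. *)
Definition alt_kernel f := forall q, alt_coef (q * f) = 0.

Lemma alt_kernel_ideal : ideal_pred alt_kernel.
Proof.
split=> [q|f g Kf Kg q|p f Kf q]; first by rewrite mulr0 alt_coef0.
  by rewrite mulrDr alt_coefD Kf Kg addr0.
by rewrite mulrA Kf.
Qed.

(* Both signs are that of the Vandermonde product [\prod_(i < j) (s j - s i)]. *)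
Lemma sign_permE s : (-1) ^+ s
  = \prod_(i < n) \prod_(j < n | (i < j)%N) (-1) ^+ (s j < s i)%N :> C.
Proof.
pose P (s : 'S_n) : C := \prod_(i < n) \prod_(j < n | (i < j)%N) ((s j)%:R - (s i)%:R).
pose V : 'M[C]_n := Vandermonde n (\row_i i%:R).
have PE t : P t = (-1) ^+ t * \det V.
  have <- : \det (Vandermonde n (\row_i (t i)%:R)) = P t.
    rewrite det_Vandermonde; apply: eq_bigr => i _; apply: eq_bigr => j _.
    by rewrite !mxE.
  have -> : Vandermonde n (\row_i (t i)%:R) = col_perm t V :> 'M[C]_n.
    by apply/matrixP => i j; rewrite !mxE.
  by rewrite col_permE det_mulmx det_perm odd_permV mulrC.
have nzP t : P t != 0.
  apply/prodf_neq0 => i _; apply/prodf_neq0 => j lt_ij.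
  rewrite subr_eq0 eqr_nat (inj_eq val_inj) (inj_eq perm_inj).
  by rewrite -val_eqE neq_ltn lt_ij orbT.
have normP : `|P s| = P 1%g.
  have -> : P 1%g = `|P 1%g|.
    rewrite ger0_norm //; apply: prodr_ge0 => i _; apply: prodr_ge0 => j lt_ij.
    by rewrite !perm1 subr_ge0 ler_nat ltnW.
  by rewrite !PE odd_perm1 mul1r normrM normr_sign mul1r.
have P1 : P 1%g = \det V by rewrite PE odd_perm1 mul1r.
apply: (mulIf (nzP 1%g)); rewrite {1}P1 -PE -normP /P.
rewrite normr_prod -big_split; apply: eq_bigr => i _ /=.
rewrite normr_prod -big_split; apply: eq_bigr => j lt_ij /=.
case: ltnP => [lt_sji|le_sij].
  by rewrite ltr0_norm ?subr_lt0 ?ltr_nat // expr1 mulN1r opprK.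
by rewrite mul1r ger0_norm // subr_ge0 ler_nat.
Qed.
End Antisymmetrizer.

(** * Monomials of [theta] and their antisymmetrization *)

Section Witness.
Variables (C : numFieldType) (n : nat).
Implicit Types (m : 'X_{1..n}) (S : {set 'I_n}).

Definition inv_sign S m : C :=
  \prod_(i in S) \prod_(j in S | (i < j)%N) (-1) ^+ (m j < m i)%N.

(** For [#|S| = k], one exponent for each bijection from [S] to [{1, .., k}]; [t] is the preimage of
    [k]. *)
Fixpoint theta_mnms k S : seq 'X_{1..n} :=
  if k is k'.+1 then
    flatten [seq [seq (U_(t) *+ k + m)%MM | m <- theta_mnms k' (S :\ t)] | t <- enum S]
  else [:: 0%MM].

Lemma theta_mnmsP k S m : #|S| = k -> m \in theta_mnms k S ->
  [/\ forall i, i \notin S -> m i = 0%N, forall i, i \in S -> (0 < m i <= k)%N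
    & {in S &, injective m}].
Proof.
elim: k S m => [|k IHk] S m /=.
  move/eqP; rewrite cards_eq0 => /eqP ->; rewrite inE => /eqP ->.
  by split=> [i _|i|i j]; rewrite ?inE ?mnm0E.
move=> cS /flatten_mapP[t]; rewrite mem_enum => tS /mapP[m' m'l ->] {m}.
have cSt : #|S :\ t| = k by have := cardsD1 t S; rewrite tS cS => -[].
have [m0 mk inj_m] := IHk _ _ cSt m'l.
have mE i : (U_(t) *+ k.+1 + m')%MM i = if i == t then k.+1 else m' i.
  rewrite mnmDE mulmnE mnm1E eq_sym; have [->|_] := eqVneq i t; last by [].
  by rewrite mul1n m0 ?addn0 // setD11.
have mSt i : i \in S -> i != t -> (0 < m' i <= k)%N.
  by move=> iS it; apply: mk; rewrite !inE it.
split=> [i iS|i iS|i j iS jS]; rewrite !mE.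
- case: eqP iS => [->|_ iS]; first by rewrite tS.
  by rewrite m0 // !inE (negPf iS) andbF.
- by case: eqVneq => [_|it]; rewrite ?ltnSn //; have := mSt i iS it; lia.
- case: eqVneq => [->|it]; case: eqVneq => [-> //|jt].
  + by have := mSt j jS jt; lia.
  + by have := mSt i iS it; lia.
  + by apply: inj_m; rewrite !inE ?it ?jt.
Qed.

Lemma theta_mnms_size k S : #|S| = k -> (0 < size (theta_mnms k S))%N.
Proof.
elim: k S => [|k IHk] S //= cS.
have [t tS] : exists t, t \in S by apply/set0Pn; rewrite -card_gt0 cS.
have cSt : #|S :\ t| = k by have := cardsD1 t S; rewrite tS cS => -[].
have := IHk _ cSt; case E: (theta_mnms _ _) => [//|m l] _.
rewrite -has_predT; apply/hasP; exists (U_(t) *+ k.+1 + m)%MM => //.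
apply/flatten_mapP; exists t; rewrite ?mem_enum //; apply/map_f.
by rewrite E mem_head.
Qed.

(** The exponent [k.+1] at [t] exceeds all others, so the inversions involving [t] are the pairs
    [(t, a)] with [t < a]. *)
Lemma inv_sign_insert k S t m : #|S| = k.+1 -> t \in S -> m \in theta_mnms k (S :\ t) ->
  inv_sign S (U_(t) *+ k.+1 + m)%MM
  = (-1) ^+ #|[set a in S :\ t | (t < a)%N]| * inv_sign (S :\ t) m.
Proof.
move=> cS tS ml.
have cSt : #|S :\ t| = k by have := cardsD1 t S; rewrite tS cS => -[].
have [m0 mk _] := theta_mnmsP cSt ml.
have mE i : (U_(t) *+ k.+1 + m)%MM i = if i == t then k.+1 else m i.
  rewrite mnmDE mulmnE mnm1E eq_sym; have [->|_] := eqVneq i t; last by [].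
  by rewrite mul1n m0 ?addn0 // setD11.
have le_mk i : (m i <= k)%N.
  by have [/mk/andP[]|/m0->] := boolP (i \in S :\ t).
rewrite /inv_sign (bigD1 t) //=; congr (_ * _).
  rewrite -sum1dep_card -prodrXr big_mkcond [RHS]big_mkcond /=; apply: eq_bigr => j _.
  rewrite !inE !mE eqxx; have [->|jt] := eqVneq j t; first by rewrite ltnn andbF.
  by rewrite ltnS le_mk.
apply: eq_big => [i|i /andP[iS it]]; first by rewrite !inE andbC.
rewrite big_mkcond [RHS]big_mkcond; apply: eq_bigr => j _; rewrite !inE !mE (negPf it).
have [->|//] := eqVneq j t; have /negPf -> : ~~ (k.+1 < m i)%N by rewrite -leqNgt leqW.
by case: ifP.
Qed.

(** Leibniz expansion of the determinant of the [x_t^m], for [t] in [S] and [1 <= m <= k]; the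
    recursion of [theta] is the Laplace expansion along the exponent [k]. *)
Lemma thetaE k S : #|S| = k ->
  theta C k S = \sum_(m <- theta_mnms k S) inv_sign S m *: 'X_[m].
Proof.
elim: k S => [|k IHk] S cS /=.
  rewrite big_seq1 mpolyX0; have /eqP := cS; rewrite cards_eq0 => /eqP ->.
  by rewrite eqxx /inv_sign big1 ?scale1r // => i; rewrite inE.
rewrite big_flatten big_map big_enum /=; apply: eq_bigr => t tS.
have cSt : #|S :\ t| = k by have := cardsD1 t S; rewrite tS cS => -[].
rewrite IHk // mulr_sumr big_map !big_seq; apply: eq_bigr => m ml.
rewrite inv_sign_insert // mpolyXD -mpolyXn -scalerA -!mul_mpolyC /eps.
by rewrite rmorphXn rmorphN1; ring.
Qed.

Lemma card_ord_interval k : (k < n)%N -> #|[set i : 'I_n | (0 < i <= k)%N]| = k.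
Proof.
move=> lt_kn.
rewrite -sum1dep_card (eq_bigl (fun i : 'I_n => (0 < i)%N && (i < k.+1)%N)) //.
rewrite -(big_ord_widen_cond _ (fun i => (0 < i)%N) (fun=> 1%N) lt_kn).
by rewrite big_mkcond big_ord_recl /= sum1_card card_ord.
Qed.

(* On the monomials of [theta k S] times [\prod_(i \notin S) x_i^i], where
   [S = {1, .., k}], [alt_coef] is the sign which that monomial has in
   [theta k S], so that no cancellation occurs. *)
Lemma alt_coef_theta_neq0 k (S := [set i : 'I_n | (0 < i <= k)%N]) : (k < n)%N ->
  alt_coef ('X_[[multinom (if i \in S then 0 else i)%N | i < n]] * theta C k S) != 0.
Proof.
move=> lt_kn; have cS : #|S| = k := card_ord_interval lt_kn.
set mu := [multinom _ | i < n]; rewrite thetaE // mulr_sumr alt_coef_sum.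
rewrite big_seq (eq_bigr (fun=> 1)) => [|m ml].
  rewrite -big_seq (_ : \sum_(_ <- _) 1 = (size (theta_mnms k S))%:R).
    by rewrite pnatr_eq0 -lt0n theta_mnms_size.
  by rewrite -sum1_size natr_sum.
have [m0 mk inj_m] := theta_mnmsP cS ml.
have ME i : (mu + m)%MM i = if i \in S then m i else i.
  by rewrite mnmDE mnmE; case: ifPn => [//|/m0 ->]; rewrite addn0.
have M_lt i : ((mu + m)%MM i < n)%N.
  by rewrite ME; case: ifP => // /mk /andP[_ le_mk]; apply: leq_ltn_trans lt_kn.
have M_inj : injective (fun i => Ordinal (M_lt i)).
  move=> i j /(congr1 val) /=; rewrite !ME; have := inj_m i j.
  have [iS|iS] := boolP (i \in S); have [jS|jS] := boolP (j \in S).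
  - exact.
  - by move=> _ E; have := mk i iS; move: jS; rewrite inE -E => /negPf ->.
  - by move=> _ E; have := mk j jS; move: iS; rewrite inE E => /negPf ->.
  - by move=> _ /val_inj.
have DM : perm_mnm (perm M_inj) = (mu + m)%MM by apply/mnmP => i; rewrite mnmE permE.
rewrite -scalerAr -mpolyXD alt_coefZ.
suff -> : alt_coef 'X_[mu + m] = inv_sign S m.
  rewrite -big_split big1 //= => i _; rewrite -big_split big1 //= => j _.
  by rewrite -expr2 sqrr_sign.
rewrite /alt_coef (bigD1 (perm M_inj)) //= big1 ?addr0 => [|s ne_s].
  rewrite mcoeffX DM eqxx mulr1 sign_permE /inv_sign [RHS]big_mkcond.
  (* Indices outside [S] are fixed and are [0] or exceed [k], while [S] is mapped into [{1, .., k}];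
     so inversions lie within [S]. *)
  have noinv (i j : 'I_n) : (i < j)%N -> ~~ ((i \in S) && (j \in S)) ->
      ((mu + m)%MM j < (mu + m)%MM i)%N = false.
    rewrite !ME; have := mk i; have := mk j; rewrite !inE.
    by case: ifP => ? ?; case: ifP => ? ?; lia.
  apply: eq_bigr => i _; have [iS|iS] := boolP (i \in S); last first.
    by apply: big1 => j lt_ij; rewrite !permE /= noinv // (negPf iS).
  rewrite big_mkcond [RHS]big_mkcond; apply: eq_bigr => j _; rewrite !permE /=.
  case: (ltnP i j) => lt_ij; last by rewrite andbF.
  rewrite andbT; case: ifPn => jS; last by rewrite noinv // iS.
  by rewrite !ME iS jS.
rewrite mcoeffX; case: eqP => [E|_]; last by rewrite mulr0.
case/eqP: ne_s; apply/permP => i; apply: val_inj.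
by have /mnmP/(_ i) := etrans DM E; rewrite !mnmE.
Qed.

End Witness.

Theorem theorem14 (C : numClosedFieldType) (n : nat) (hn : (1 <= n)%N) :
  (forall (k l : nat) (w : pform C n),
      (k <= n)%N -> (binomial n 2 < l + binomial k.+1 2)%N ->
      in_Omega l k w -> in_I w)
  /\
  (forall k : nat, (k <= n.-1)%N ->
      exists w : pform C n,
        in_Omega (binomial n 2 - binomial k.+1 2) k w /\ ~ in_I w).
Proof.
split=> [k l w _|k le_kn]; first exact: in_I_large_degree.
have lt_kn : (k < n)%N by rewrite -(prednK hn).
have cS := card_ord_interval lt_kn.
have := @alt_coef_theta_neq0 C n k lt_kn.
set S := [set i | _] in cS *; set mu := [multinom _ | i < n].
move=> /= nz; exists (mono S 'X_[mu]); split=> [B|Iw]; last first.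
  have Gp l : (0 < l)%N -> @alt_kernel C n (\sum_(i < n) 'X_i ^+ l).
    by move=> l_gt0 q; apply: alt_coef_psum.
  have := theta_pairing_in_ideal k (@alt_kernel_ideal C n) Gp Iw.
  move=> /(_ 1); rewrite mul1r (bigD1 S) //= big1 ?addr0 => [|B /negPf BS].
    by rewrite ffunE eqxx => /eqP; apply/negP.
  by rewrite ffunE BS mul0r.
split; last by rewrite ffunE; have [->|//] := eqVneq B S; rewrite cS eqxx.
rewrite ffunE; case: ifP => _; last exact: dhomog0.
(* The degree of [mu] is the sum of the indices outside [S], and those in [S] sum to [C(k+1, 2)]. *)
rewrite dhomogX; apply/eqP; rewrite [LHS]mdegE.
have <- : (\sum_(i in S) i)%N = 'C(k.+1, 2).
  rewrite -bin2_sum big_mkord (big_ord_widen _ id lt_kn) big_mkcond [RHS]big_mkcond.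
  by apply: eq_bigr => i _; rewrite inE ltnS; case: (i : nat).
rewrite -bin2_sum big_mkord [in RHS](bigID (mem S)) /= addKn [RHS]big_mkcond.
by apply: eq_bigr => i _; rewrite mnmE; case: ifP.
Qed.
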